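(* Let $F=|\overline{y}|\sqrt{\phi(z,r)}$ be a Finsler metric defined on $M=\mathbb{R}\times\mathbb{B}^n(\rho)$, where $z=\frac{y^0}{|\overline{y}|}$ and $r=|\overline{x}|$. Put $s=\frac{\langle\overline{x},\overline{y}\rangle}{|\overline{y}|}$, $u=|\overline{y}|$, $\Omega=2\phi-z\phi_z$, $$U=\frac{2\phi\phi_{zr}-\phi_z\phi_r}{2r(2\phi\phi_{zz}-\phi_z^2)},\quad V=\frac{\phi_r\phi_{zz}-\phi_z\phi_{zr}}{2r(2\phi\phi_{zz}-\phi_z^2)},\quad W=\frac{\phi_r}{2r(2\phi-z\phi_z)},$$ $$E=U+zV,\qquad H=V+W.$$ Then the Landsberg curvature of $F$ is given by $$L_{000}=-\frac s4\left(\phi_zE_{zzz}+\Omega(H_{zzz}-W_{zzz})\right),$$ $$L_{00l}=-\frac14(\phi_zE_{zz}+\Omega H_{zz})x^l+\frac s{4u}\left(\phi_z(E_{zz}+zE_{zzz})+\Omega(H_{zz}+zH_{zzz}-zW_{zzz})\right)y^l,$$ $$\begin{aligned}L_{0kl}=&-\frac s{4u^2}\Big(z\phi_z(zE_{zzz}+3E_{zz})+\Omega(H_z+3zH_{zz}+z^2H_{zzz})+\Omega(W_z-zW_{zz}-z^2W_{zzz})\Big)y^ky^l\\&+\frac z{4u}\left(\phi_zE_{zz}+\Omega H_{zz}\right)(x^ly^k+x^ky^l)\\&+\frac s4\left(z\phi_zE_{zz}+\Omega(H_z+zH_{zz}+W_z-zW_{zz})\right)\delta^{kl},\end{aligned}$$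 $$\begin{aligned}L_{jkl}=&-\frac s{4u^3}\Big(\phi_z[3E-3zE_z-6z^2E_{zz}-z^3E_{zzz}]-\Omega[6zH_z+6z^2H_{zz}+z^3H_{zzz}]\\&\qquad\quad-\Omega[3zW_z-3z^2W_{zz}-z^3W_{zzz}]\Big)y^jy^ky^l\\&-\frac1{4u^2}\left(\phi_z[-E+zE_z+z^2E_{zz}]+\Omega[zH_z+z^2H_{zz}]\right)(x^jy^ky^l)_{\overrightarrow{jkl}}\\&-\frac s{4u}\left(\phi_z[-E+zE_z+z^2E_{zz}]+\Omega[2zH_z+z^2H_{zz}+zW_z-z^2W_{zz}]\right)(y^l\delta^{jk})_{\overrightarrow{jkl}}\\&-\frac14\left(\phi_z[E-zE_z]-z\Omega H_z\right)(x^l\delta^{jk})_{\overrightarrow{jkl}},\end{aligned}$$ for all $j,k,l\in\{1,\dots,n\}$.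
   Context: Let $n\ge 2$, let $\mathbb{B}^n(\rho)\subset\mathbb{R}^n$ be the open ball of radius $\rho$ centred at the origin, and $M=\mathbb{R}\times\mathbb{B}^n(\rho)$ (so $\dim M=n+1$), with coordinates $x=(x^0,\overline{x})$, $\overline{x}=(x^1,\dots,x^n)$ and tangent coordinates $y=(y^0,\overline{y})$, $\overline{y}=(y^1,\dots,y^n)$; $|\cdot|$, $\langle\cdot,\cdot\rangle$ are the Euclidean norm and inner product on $\mathbb{R}^n$. Capital indices run over $0,\dots,n$, lower case indices over $1,\dots,n$; subscripts $z,r$ denote partial derivatives. A Finsler metric on $M$ is a function $F:TM\to[0,\infty)$ that is $C^\infty$ on $TM\setminus\{0\}$ and restricts to a Minkowski norm on each tangent space. The metrics considered have the form $F=|\overline{y}|\sqrt{\phi(z,r)}$ with $\phi$ a differentiable function of $z$ and $r$; formulas are read at points with $\overline{y}\neq0$, $\overline{x}\neq0$. The notation $(\cdot)_{\overrightarrow{jkl}}$ means the sum of the expression over the three cyclic permutations of the indices $j,k,l$. With $g_{AB}=\frac12[F^2]_{y^Ay^B}$, the spray coefficients are $G^C=\frac14 g^{CA}\left([F^2]_{y^Ax^B}y^B-[F^2]_{x^A}\right)$ (sum over repeated indices), and the Landsberg curvature is $L_{ABC}=-\frac14[F^2]_{y^D}\,\frac{\partial^3G^D}{\partial y^A\partial y^B\partial y^C}$. *)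

(* Defs.v *)
From HB Require Import structures.
From mathcomp Require Import all_boot all_order all_algebra.
From mathcomp Require Import all_classical all_reals all_analysis.

Set Implicit Arguments.
Unset Strict Implicit.
Unset Printing Implicit Defensive.

Import Order.TTheory GRing.Theory Num.Theory.
Import numFieldNormedType.Exports.

Local Open Scope classical_set_scope.
Local Open Scope ring_scope.

(* The library's norm `| v | on row vectors is the sup norm, hence these two. *)
Definition dotp (R : realType) (m : nat) (v w : 'rV[R]_m) : R :=
  \sum_(i < m) v 0 i * w 0 i.

Definition enorm (R : realType) (m : nat) (v : 'rV[R]_m) : R :=
  Num.sqrt (dotp v v).

(* v = (v^0, v^1, ..., v^n) is split into v^0 = [v 0 0] and
   (v^1, ..., v^n) = [bar v]; a lower case index i in {1, ..., n} of the
   mathematics is an element of 'I_n, and corresponds to the capital index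
   [lift ord0 i] : 'I_n.+1. *)
Definition bar (R : realType) (n : nat) (v : 'rV[R]_n.+1) : 'rV[R]_n :=
  \row_(i < n) v 0 (lift ord0 i).

Definition RxBall (R : realType) (n : nat) (rho : R) : set 'rV[R]_n.+1 :=
  [set x | enorm (bar x) < rho].

Arguments RxBall {R} n rho.

(* C^oo on an open set D: every iterated directional derivative of f is
   (Frechet) differentiable at every point of D. *)
Definition smooth_on (R : realType) (V : normedModType R) (D : set V)
    (f : V -> R) : Prop :=
  forall (vs : seq V) (p : V), D p ->
    differentiable (foldr (fun v (g : V -> R) => 'D_v g) f vs) p.

Definition pd (R : realType) (m : nat) (A : 'I_m) (f : 'rV[R]_m -> R) :
    'rV[R]_m -> R :=
  'D_(delta_mx 0 A) f.

(* Functions on TM are curried, f x y with x the base point. *)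
Definition dx (R : realType) (m : nat) (A : 'I_m)
    (f : 'rV[R]_m -> 'rV[R]_m -> R) : 'rV[R]_m -> 'rV[R]_m -> R :=
  fun x y => pd A (fun x' => f x' y) x.

Definition dy (R : realType) (m : nat) (A : 'I_m)
    (f : 'rV[R]_m -> 'rV[R]_m -> R) : 'rV[R]_m -> 'rV[R]_m -> R :=
  fun x y => pd A (f x) y.

Definition half_hessian_sq (R : realType) (m : nat) (N : 'rV[R]_m -> R)
    (y : 'rV[R]_m) : 'M[R]_m :=
  \matrix_(A, B) (2^-1 * pd B (pd A (fun y' => N y' ^+ 2)) y).

Definition minkowski_norm (R : realType) (m : nat) (N : 'rV[R]_m -> R) : Prop :=
  [/\ forall y : 'rV[R]_m, 0 <= N y,
      smooth_on [set y : 'rV[R]_m | y != 0] N,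
      forall (l : R) (y : 'rV[R]_m), 0 < l -> N (l *: y) = l * N y
    & forall y v : 'rV[R]_m, y != 0 -> v != 0 ->
        0 < (v *m half_hessian_sq N y *m v^T) 0 0].

(* M is an open subset of R^m, and TM = M * R^m. *)
Definition finsler_metric (R : realType) (m : nat) (M : set 'rV[R]_m)
    (F : 'rV[R]_m -> 'rV[R]_m -> R) : Prop :=
  smooth_on [set p : 'rV[R]_m * 'rV[R]_m | M p.1 /\ p.2 != 0]
            (fun p => F p.1 p.2) /\
  forall x : 'rV[R]_m, M x -> minkowski_norm (F x).

Definition Fsq (R : realType) (m : nat) (F : 'rV[R]_m -> 'rV[R]_m -> R) :
    'rV[R]_m -> 'rV[R]_m -> R :=
  fun x y => F x y ^+ 2.

Definition fundamental_tensor (R : realType) (m : nat)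
    (F : 'rV[R]_m -> 'rV[R]_m -> R) (x y : 'rV[R]_m) : 'M[R]_m :=
  half_hessian_sq (F x) y.

Definition spray (R : realType) (m : nat) (F : 'rV[R]_m -> 'rV[R]_m -> R)
    (C : 'I_m) : 'rV[R]_m -> 'rV[R]_m -> R := fun x y =>
  4^-1 * \sum_(A < m) invmx (fundamental_tensor F x y) C A *
    (\sum_(B < m) dx B (dy A (Fsq F)) x y * y 0 B - dx A (Fsq F) x y).

Definition landsberg (R : realType) (m : nat) (F : 'rV[R]_m -> 'rV[R]_m -> R)
    (A B C : 'I_m) : 'rV[R]_m -> 'rV[R]_m -> R := fun x y =>
  - 4^-1 * \sum_(D < m)
    dy D (Fsq F) x y * dy A (dy B (dy C (spray F D))) x y.

Definition dz (R : realType) (f : R -> R -> R) : R -> R -> R :=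
  fun z r => derive1 (fun t : R => f t r) z.

Definition dr (R : realType) (f : R -> R -> R) : R -> R -> R :=
  fun z r => derive1 (fun t : R => f z t) r.

Definition Omega (R : realType) (phi : R -> R -> R) : R -> R -> R :=
  fun z r => 2 * phi z r - z * dz phi z r.

Definition Ucoef (R : realType) (phi : R -> R -> R) : R -> R -> R := fun z r =>
  (2 * phi z r * dr (dz phi) z r - dz phi z r * dr phi z r) /
  (2 * r * (2 * phi z r * dz (dz phi) z r - dz phi z r ^+ 2)).

Definition Vcoef (R : realType) (phi : R -> R -> R) : R -> R -> R := fun z r =>
  (dr phi z r * dz (dz phi) z r - dz phi z r * dr (dz phi) z r) /
  (2 * r * (2 * phi z r * dz (dz phi) z r - dz phi z r ^+ 2)).

Definition Wcoef (R : realType) (phi : R -> R -> R) : R -> R -> R := fun z r =>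
  dr phi z r / (2 * r * (2 * phi z r - z * dz phi z r)).

Definition Ecoef (R : realType) (phi : R -> R -> R) : R -> R -> R :=
  fun z r => Ucoef phi z r + z * Vcoef phi z r.

Definition Hcoef (R : realType) (phi : R -> R -> R) : R -> R -> R :=
  fun z r => Vcoef phi z r + Wcoef phi z r.

(* The sum of T over the three cyclic permutations of (j, k, l). *)
Definition cyc (R : realType) (n : nat) (T : 'I_n -> 'I_n -> 'I_n -> R)
    (j k l : 'I_n) : R :=
  T j k l + T k l j + T l j k.

Definition kron (R : realType) (n : nat) (k l : 'I_n) : R := (k == l)%:R.

Arguments kron R {n} k l.

(* Main.v *)
Require Import Defs.
From HB Require Import structures.
From mathcomp Require Import all_boot all_order all_algebra.
From mathcomp Require Import all_classical all_reals all_analysis.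
From mathcomp Require Import ring.
Import Order.TTheory GRing.Theory Num.Theory.
Import numFieldNormedType.Exports.
Local Open Scope classical_set_scope.
Local Open Scope ring_scope.

Set Implicit Arguments.
Unset Strict Implicit.
Unset Printing Implicit Defensive.

(** Put [u = |bar y|], [z = y^0 / u], [r = |bar x|] and [p = <bar x, bar y>]. Where
    [bar y] does not vanish, the square of [F] is [u^2 phi(z, r)], with first
    derivatives [u phi_z] along [e_0] and [Omega y^i] along [e_i]. Solving the
    linear system that defines the spray gives
      [G^0 = u p E]   and   [G^i = p H y^i - u^2 W x^i]
    ([spray_vecE]): the part along [bar x] yields [W], and the parts along [e_0]
    and [bar y] form a system of size two whose determinant is
    [Delta = 2 phi phi_zz - phi_z^2], which yields [E] and [V].

    The theorem is then a computation of third derivatives. All functions in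
    sight are products of linear forms in [y] with functions [u^a f(z)], and for
    those
      [D_v (u^a f(z)) = u^(a-1) f'(z) v^0 + u^(a-2) (a f - z f')(z) <y, v>]
    is again of this kind. Three iterations ([jet3_mono]), the Leibniz rule for
    the linear factors ([jet3_linear]) and the contraction with the first
    derivatives of the square of [F] give one formula valid for arbitrary
    directions ([landsberg_directional]). Its values at [e_0] and [e_i] are the
    four formulas.

    Derivatives being total functions, each step needs actual derivability, and
    divisions need nonzero denominators. Positive definiteness of the fundamental
    tensor gives [0 < Omega], tested on a spatial vector orthogonal to [bar y],
    and [0 < Delta], tested on the plane of [e_0] and [bar y]. Smoothness of [phi]
    has to be extracted from that of [F]: restricted to suitable affine families
    of points and vectors, the square of [F] is a smooth function of [(z, r)],
    equal to [phi] wherever [phi] is nonnegative ([profile]). If it vanished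
    somewhere, [Delta] would be nonpositive there; hence it is positive, and
    equals [phi] for [0 < r < rho] ([profileE]). *)

(** * Differentiation along directions *)

Definition linform (R : realType) (U : lmodType R) (l : U -> R) : Prop :=
  forall h q w, l (h *: w + q) = h * l w + l q.

Lemma is_derive_linear (R : realType) (V : normedModType R) (l : V -> R)
    (p v : V) : linform l -> is_derive p v l (l v).
Proof.
move=> ll.
suff H : (fun h => h^-1 *: ((l \o shift p) (h *: v) - l p)) @ 0^' --> l v.
  by apply: DeriveDef; [apply/cvg_ex; exists (l v)|apply: cvg_lim].
apply: cvg_near_cst; near=> h.
have h0 : h != 0 by near: h; exact: nbhs_dnbhs_neq.
by rewrite /= ll addrK /GRing.scale /= mulKf.
Unshelve. all: by end_near. Qed.

Section DirectionalSmoothness.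
Variables (R : realType) (V : normedModType R).
Implicit Types (D : set V) (f g : V -> R) (p v : V).

(** Differentiability in the sense of Frechet is not asked for: the formulas
    below only involve iterated directional derivatives, and derivability along
    a direction is stable under local equality and pointwise operations. *)
Definition dsmooth D f : Prop := forall (vs : seq V) p v, D p ->
  derivable (foldr (fun w (h : V -> R) => 'D_w h) f vs) p v.

Lemma smooth_on_dsmooth D f : smooth_on D f -> dsmooth D f.
Proof. by move=> sf vs p v Dp; apply: diff_derivable; apply: sf. Qed.

Lemma dsmooth_derivable D f p v : dsmooth D f -> D p -> derivable f p v.
Proof. by move=> sf Dp; apply: (sf [::]). Qed.

Lemma dsmooth_derive D f v : dsmooth D f -> dsmooth D ('D_v f).
Proof.
move=> sf vs p w Dp.
by have := sf (rcons vs v) p w Dp; rewrite foldr_rcons.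
Qed.

Lemma open_near_eq D f g p : open D -> (forall q, D q -> f q = g q) -> D p ->
  {near p, f =1 g}.
Proof.
move=> oD fg Dp; have := open_nbhs_nbhs (conj oD Dp).
by apply: filterS => q; exact: fg.
Qed.

Lemma derive_eq_on D f g v : open D -> (forall q, D q -> f q = g q) ->
  (forall q, D q -> 'D_v f q = 'D_v g q).
Proof.
move=> oD fg p Dp.
by apply: near_eq_derive; apply: open_near_eq fg Dp.
Qed.

(** A coinduction principle: a class of functions that is stable under every
    directional derivative, up to equality on [D], consists of smooth
    functions. The derivatives of a list are peeled off from its last entry,
    which is the one applied first. *)
Lemma dsmooth_coind D (C : (V -> R) -> Prop) : open D ->
  (forall f, C f -> (forall p v, D p -> derivable f p v) /\
     forall v, exists2 g, C g & (forall q, D q -> 'D_v f q = g q)) ->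
  forall f, C f -> dsmooth D f.
Proof.
move=> oD HC f Cf vs; elim/last_ind: vs f Cf => [|vs w IH] f Cf p v Dp.
  exact: (HC f Cf).1.
rewrite foldr_rcons; have [g Cg fg] := (HC f Cf).2 w.
have {}fg : forall q, D q -> foldr (fun w (h : V -> R) => 'D_w h) ('D_w f) vs q =
    foldr (fun w (h : V -> R) => 'D_w h) g vs q.
  by elim: vs {IH} => //= w' vs IH; apply: derive_eq_on.
apply: (near_eq_derivable _ (IH g Cg p v Dp)).
by apply: (open_near_eq oD _ Dp) => q Dq; rewrite fg.
Qed.

Lemma dsmooth_eq D f g : open D -> (forall q, D q -> f q = g q) ->
  dsmooth D f -> dsmooth D g.
Proof.
move=> oD fg sf.
apply: (@dsmooth_coind D (fun h => exists2 k, dsmooth D k &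
  forall q, D q -> k q = h q)) => //; last by exists f.
move=> h [k sk kh]; split=> [p v Dp|v].
  apply: (near_eq_derivable (open_near_eq oD kh Dp)).
  exact: dsmooth_derivable sk Dp.
exists ('D_v k); last by move=> q Dq; rewrite (derive_eq_on v oD kh).
by exists ('D_v k); first exact: dsmooth_derive.
Qed.

(** The Leibniz and quotient rules keep this closure stable under derivation,
    so that a single coinduction treats sums, products and inverses. *)
Inductive algebraic_in D : (V -> R) -> Prop :=
| algebraic_base f of dsmooth D f : algebraic_in D f
| algebraic_add f g of algebraic_in D f & algebraic_in D g :
    algebraic_in D (f + g)
| algebraic_mul f g of algebraic_in D f & algebraic_in D g :
    algebraic_in D (f * g)
| algebraic_inv f of algebraic_in D f & (forall p, D p -> f p != 0) :
    algebraic_in D (fun p => (f p)^-1).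

Lemma dsmooth_cst D (c : R) : open D -> dsmooth D (cst c).
Proof.
move=> oD; apply: (@dsmooth_coind D (fun f => exists c, f = cst c)) => //;
  last by exists c.
move=> _ [k ->]; split=> [p v _|v]; first exact: derivable_cst.
by exists (cst 0); [exists 0 | move=> p _; rewrite derive_cst].
Qed.

Lemma algebraic_dsmooth D f : open D -> algebraic_in D f -> dsmooth D f.
Proof.
move=> oD Cf; apply: dsmooth_coind Cf => // {}f; elim.
- move=> {}f sf; split=> [p v Dp|v]; first exact: dsmooth_derivable sf Dp.
  by exists ('D_v f) => //; apply: algebraic_base; apply: dsmooth_derive.
- move=> {}f g Cf [df Df] Cg [dg Dg]; split=> [p v Dp|v].
    by apply: derivableD; [apply: df|apply: dg].
  have [f' Cf' ff'] := Df v; have [g' Cg' gg'] := Dg v.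
  exists (f' + g'); first exact: algebraic_add.
  move=> p Dp.
  by rewrite /= deriveD ?ff' ?gg' //; [apply: df|apply: dg].
- move=> {}f g Cf [df Df] Cg [dg Dg]; split=> [p v Dp|v].
    by apply: derivableM; [apply: df|apply: dg].
  have [f' Cf' ff'] := Df v; have [g' Cg' gg'] := Dg v.
  exists (f * g' + g * f'); first by apply: algebraic_add; apply: algebraic_mul.
  move=> p Dp.
  by rewrite /= deriveM ?ff' ?gg' //; [apply: df|apply: dg].
- move=> {}f Cf [df Df] f0; split=> [p v Dp|v].
    by apply: derivableV; [apply: f0|apply: df].
  have [f' Cf' ff'] := Df v.
  have Cv := algebraic_inv Cf f0.
  exists (cst (-1) * (((fun p => (f p)^-1) * (fun p => (f p)^-1)) * f')).
    apply: algebraic_mul; first exact/algebraic_base/dsmooth_cst.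
    by apply: algebraic_mul => //; apply: algebraic_mul.
  move=> p Dp.
  rewrite /= deriveV ?ff' //; [|exact: f0|exact: df].
  by rewrite /GRing.scale /= expr2 invfM !mulrfctE /= mulN1r mulNr.
Qed.

Lemma dsmoothD D f g : open D -> dsmooth D f -> dsmooth D g ->
  dsmooth D (f + g).
Proof.
by move=> oD sf sg; apply: algebraic_dsmooth => //; apply: algebraic_add;
  apply: algebraic_base.
Qed.

Lemma dsmoothM D f g : open D -> dsmooth D f -> dsmooth D g ->
  dsmooth D (f * g).
Proof.
by move=> oD sf sg; apply: algebraic_dsmooth => //; apply: algebraic_mul;
  apply: algebraic_base.
Qed.

Lemma dsmoothV D f : open D -> dsmooth D f -> (forall p, D p -> f p != 0) ->
  dsmooth D (fun p => (f p)^-1).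
Proof.
by move=> oD sf f0; apply: algebraic_dsmooth => //; apply: algebraic_inv => //;
  apply: algebraic_base.
Qed.

Lemma dsmooth_linear D (l : V -> R) : open D -> linform l -> dsmooth D l.
Proof.
move=> oD ll.
have dl p v : is_derive p v l (l v) by apply: is_derive_linear.
apply: (@dsmooth_coind D (fun f => f = l \/ exists c, f = cst c)) => //;
  last by left.
move=> f [->|[c ->]]; split=> [p v _|v].
- exact: ex_derive.
- by exists (cst (l v)); [right; exists (l v)|move=> p _; rewrite derive_val].
- exact: derivable_cst.
- by exists (cst 0); [right; exists 0|move=> p _; rewrite derive_cst].
Qed.
End DirectionalSmoothness.

(** The two difference quotients are equal, so the derivatives agree even where
    neither of them exists. *)
Lemma derive_affine (R : realType) (V W : normedModType R) (A L : V -> W)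
    (f : W -> R) (p v : V) :
  (forall h q w, A (h *: w + q) = h *: L w + A q) ->
  ('D_v (f \o A) p = 'D_(L v) f (A p)) *
  (derivable f (A p) (L v) -> derivable (f \o A) p v).
Proof.
move=> AL.
have E : (fun h => h^-1 *: ((f \o shift (A p)) (h *: L v) - f (A p))) =
         (fun h => h^-1 *: (((f \o A) \o shift p) (h *: v) - (f \o A) p)).
  by apply/funext => h /=; rewrite AL.
by split; rewrite /derive /derivable E.
Qed.

Lemma dsmooth_affine (R : realType) (V W : normedModType R) (A L : V -> W)
    (D : set V) (D' : set W) (f : W -> R) : open D ->
  (forall h q w, A (h *: w + q) = h *: L w + A q) ->
  (forall p, D p -> D' (A p)) -> dsmooth D' f -> dsmooth D (f \o A).
Proof.
move=> oD AL DD sf.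
apply: (@dsmooth_coind _ _ D
  (fun h => exists2 k, dsmooth D' k & h = k \o A)) => //; last by exists f.
move=> _ [k sk ->]; split=> [p v Dp|v].
  apply: (derive_affine k p v AL).2.
  by apply: dsmooth_derivable sk _; apply: DD.
exists ('D_(L v) k \o A); last by move=> p _; rewrite (derive_affine k p v AL).1.
by exists ('D_(L v) k); first exact: dsmooth_derive.
Qed.

(** Restricting to a line reduces the chain rule below to the chain rule for
    functions of one variable. *)
Lemma is_derive_line (R : realType) (V : normedModType R) (f : V -> R)
    (x v : V) (d : R) :
  is_derive (0 : R) (1 : R) (fun h : R => f (h *: v + x)) d <->
  is_derive x v f d.
Proof.
set F := fun h : R => f (h *: v + x).
have E : 'D_1 F 0 = 'D_v f x.
  rewrite /derive; set k1 := fun h => _; set k2 := fun h => _.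
  suff -> : k1 = k2 by []. apply/funext => h; rewrite /k1 /k2.
  by rewrite /F /= addr0 scale0r add0r [_%:A]mulr1.
split=> -[df Ef]; apply: DeriveDef.
- exact: (derivable1P f x v).2.
- by rewrite -E.
- exact: (derivable1P f x v).1.
- by rewrite E.
Qed.

Lemma is_derive_comp1 (R : realType) (V : normedModType R) (h : V -> R)
    (g : R -> R) (x v : V) (dh dg : R) :
  is_derive x v h dh -> is_derive (h x) 1 g dg ->
  is_derive x v (fun p => g (h p)) (dg * dh).
Proof.
move=> /is_derive_line Hh Hg; apply/is_derive_line.
apply: (@is_derive1_comp _ g (fun t : R => h (t *: v + x))).
by rewrite scale0r add0r.
Qed.

(** The rules of calculus for pointwise expressions, with products instead of
    the scaling operation. *)
Section PointwiseRules.
Variables (R : realType) (V : normedModType R) (x v : V).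
Implicit Types (f g : V -> R) (a df dg : R).

Lemma is_derive_addf f g df dg : is_derive x v f df -> is_derive x v g dg ->
  is_derive x v (fun p => f p + g p) (df + dg).
Proof. exact: is_deriveD. Qed.

Lemma is_derive_subf f g df dg : is_derive x v f df -> is_derive x v g dg ->
  is_derive x v (fun p => f p - g p) (df - dg).
Proof. exact: is_deriveB. Qed.

Lemma is_derive_mulf f g df dg : is_derive x v f df -> is_derive x v g dg ->
  is_derive x v (fun p => f p * g p) (f x * dg + df * g x).
Proof. by move=> Hf Hg; rewrite [df * _]mulrC; exact: is_deriveM. Qed.

Lemma is_derive_scalef f df a : is_derive x v f df ->
  is_derive x v (fun p => f p * a) (df * a).
Proof.
move=> Hf; have := is_derive_mulf Hf (is_derive_cst a x v).
by rewrite mulr0 add0r.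
Qed.
End PointwiseRules.

(** * Inner products and the splitting of a vector *)

Section InnerProduct.
Variables (R : realType).

Lemma dotpC m (v w : 'rV[R]_m) : dotp v w = dotp w v.
Proof. by apply: eq_bigr => i _; rewrite mulrC. Qed.

Lemma dotpDl m (v v' w : 'rV[R]_m) : dotp (v + v') w = dotp v w + dotp v' w.
Proof. by rewrite -big_split; apply: eq_bigr => i _; rewrite mxE mulrDl. Qed.

Lemma dotpZl m a (v w : 'rV[R]_m) : dotp (a *: v) w = a * dotp v w.
Proof. by rewrite /dotp mulr_sumr; apply: eq_bigr => i _; rewrite mxE mulrA. Qed.

Lemma dotpZr m a (v w : 'rV[R]_m) : dotp v (a *: w) = a * dotp v w.
Proof. by rewrite dotpC dotpZl dotpC. Qed.

Lemma dotp_ge0 m (v : 'rV[R]_m) : 0 <= dotp v v.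
Proof. by apply: sumr_ge0 => i _; rewrite -expr2 sqr_ge0. Qed.

Lemma dotp_gt0 m (v : 'rV[R]_m) : v != 0 -> 0 < dotp v v.
Proof.
move=> v0; rewrite lt_def dotp_ge0 andbT; apply: contra v0.
rewrite psumr_eq0 => [/allP H|i _]; last by rewrite -expr2 sqr_ge0.
apply/eqP/rowP => i; apply/eqP; rewrite mxE.
by have /implyP := H i (mem_index_enum _); rewrite -expr2 sqrf_eq0; apply.
Qed.

Lemma enorm_gt0 m (v : 'rV[R]_m) : v != 0 -> 0 < enorm v.
Proof. by move=> v0; rewrite sqrtr_gt0 dotp_gt0. Qed.

Lemma enorm_sq m (v : 'rV[R]_m) : dotp v v = enorm v ^+ 2.
Proof. by rewrite sqr_sqrtr // dotp_ge0. Qed.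

Lemma barD m (v w : 'rV[R]_m.+1) : bar (v + w) = bar v + bar w.
Proof. by apply/rowP => i; rewrite !mxE. Qed.

Lemma barZ m a (v : 'rV[R]_m.+1) : bar (a *: v) = a *: bar v.
Proof. by apply/rowP => i; rewrite !mxE. Qed.

Lemma bar_e0 m : bar (delta_mx 0 0 : 'rV[R]_m.+1) = 0.
Proof. by apply/rowP => i; rewrite !mxE. Qed.

Lemma bar_eS m (i : 'I_m) :
  bar (delta_mx 0 (lift ord0 i) : 'rV[R]_m.+1) = delta_mx 0 i.
Proof. by apply/rowP => j; rewrite !mxE. Qed.

Lemma dotp_e m (v : 'rV[R]_m) i : dotp v (delta_mx 0 i) = v 0 i.
Proof.
rewrite /dotp (bigD1 i) //= mxE !eqxx mulr1 big1 ?addr0 // => j /negPf ji.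
by rewrite mxE ji andbF mulr0.
Qed.

Lemma dotp0 m (v : 'rV[R]_m) : dotp v 0 = 0.
Proof. by apply: big1 => i _; rewrite mxE mulr0. Qed.
End InnerProduct.

(** * Derivatives of the functions u^a f(z) *)

Section Calculus.
Variables (R : realType) (n : nat).
Notation V := 'rV[R]_n.+1.
Implicit Types (x y v w t : V).

Lemma is_derive_dotp_bar x y v :
  is_derive y v (fun y => dotp (bar x) (bar y)) (dotp (bar x) (bar v)).
Proof.
apply: (@is_derive_linear _ _ (fun y : V => dotp (bar x) (bar y))) => h v' p.
by rewrite barD barZ dotpC dotpDl dotpZl !(dotpC _ (bar x)).
Qed.

Lemma is_derive_coord0 y v : is_derive y v (fun y : V => y 0 0) (v 0 0).
Proof.
by apply: (@is_derive_linear _ _ (fun y : V => y 0 0)) => h v' p; rewrite !mxE.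
Qed.

Lemma is_derive_normsq y v :
  is_derive y v (fun y => dotp (bar y) (bar y)) (2 * dotp (bar y) (bar v)).
Proof.
have H (i : 'I_n) : is_derive y v (fun y : V => bar y 0 i) (bar v 0 i).
  by apply: (@is_derive_linear _ _ (fun y : V => bar y 0 i)) => h v' p; rewrite !mxE.
have -> : (fun y : V => dotp (bar y) (bar y)) =
   \sum_(i < n) ((fun y : V => bar y 0 i) * (fun y : V => bar y 0 i)).
  by apply/funext => y'; rewrite fct_sumE; apply: eq_bigr.
apply: is_derive_eq.
rewrite /dotp mulr_sumr; apply: eq_bigr => i _.
by rewrite /GRing.scale /= -mulr2n mulr_natl.
Qed.

Lemma is_derive_enorm y v : bar y != 0 ->
  is_derive y v (fun y => enorm (bar y)) (dotp (bar y) (bar v) / enorm (bar y)).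
Proof.
move=> y0; have Hs := is_derive1_sqrt (dotp_gt0 y0).
apply: is_derive_eq (is_derive_comp1 (is_derive_normsq y v) Hs) _.
rewrite -/(enorm _); have := enorm_gt0 y0; move: (enorm _) => u u0.
by field; rewrite gt_eqF.
Qed.

Lemma is_derive_exprz (a : int) (x : R) : x != 0 ->
  is_derive x 1 (fun c : R => c ^ a) (a%:~R * x ^ (a - 1)).
Proof.
move=> x0; case: a => [[|m]|m].
- rewrite mul0r; exact: is_derive_cst.
- have -> : (m.+1%:Z - 1) = m%:Z by rewrite -natz -addn1 natrD addrK natz.
  have := @is_deriveX R R id m.+1 x 1 1 (is_derive_id _ _).
  by rewrite exprfctE /GRing.scale /= mulr1.
- have Hx := @is_deriveX R R id m.+1 x 1 1 _.
  have xm0 : (id ^+ m.+1 : R -> R) x != 0 by rewrite exprfctE expf_neq0.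
  have Hd := Hx (is_derive_id _ _).
  apply: DeriveDef.
    have := derivableV xm0 (@ex_derive _ _ _ _ _ _ _ Hd).
    by rewrite exprfctE.
  have := deriveV xm0 (@ex_derive _ _ _ _ _ _ _ Hd).
  rewrite (@derive_val _ _ _ _ _ _ _ Hd) exprfctE /= => ->.
  rewrite /GRing.scale /= mulr1.
  have -> : Negz m - 1 = Negz m.+1 by rewrite !NegzE -opprD -PoszD addn1.
  have -> : x ^ Negz m.+1 = (x ^+ m.+2)^-1 by [].
  rewrite NegzE intrN !exprS; have : x ^+ m != 0 by rewrite expf_neq0.
  by move: (x ^+ m) => c c0; field; rewrite c0 x0.
Qed.

Lemma is_derive_slope y v : bar y != 0 ->
  is_derive y v (fun y => y 0 0 / enorm (bar y))
    (v 0 0 / enorm (bar y) -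
     y 0 0 / enorm (bar y) * dotp (bar y) (bar v) / enorm (bar y) ^+ 2).
Proof.
move=> y0; have u0 := enorm_gt0 y0.
have u0' : enorm (bar y) != 0 by rewrite gt_eqF.
have HV := is_derive_comp1 (is_derive_enorm v y0) (is_derive_exprz (-1) u0').
apply: is_derive_eq (is_derive_mulf (is_derive_coord0 y v) HV) _.
move: (enorm _) u0' => u u0'.
have -> : u ^ (-1 - 1) = (u ^+ 2)^-1 by [].
have -> : (-1 : int)%:~R = -1 :> R by [].
have -> : u ^ (-1) = u^-1 by [].
by field.
Qed.

Implicit Types (f : R -> R) (a b : int).

(** In a purely spatial direction [v] the derivative of [z] is
    [- z <y, v> / u^2] and that of [u] is [<y, v> / u], so the derivative of
    [u^a f(z)] is [u^(a-2) (a f - z f')(z) <y, v>]: this is the operator acting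
    on [f]. *)
Definition radial (a : int) (f : R -> R) : R -> R :=
  fun c => a%:~R * f c - c * (derive1 f) c.

(** The function [u^a f(z)] of [y], where [u] is the norm of the spatial part of
    [y] and [z = y^0 / u]. This family is stable under derivation up to the
    linear factors [v^0] and [<y, v>], which makes [mono1], [mono2] and [mono3]
    (its iterated derivatives, innermost direction last) recursive. *)
Definition mono (a : int) (f : R -> R) y : R :=
  enorm (bar y) ^ a * f (y 0 0 / enorm (bar y)).

Definition mono1 a f v y : R :=
  mono (a - 1) (derive1 f) y * v 0 0 + mono (a - 2) (radial a f) y * dotp (bar y) (bar v).

Definition mono2 a f v w y : R :=
  mono1 (a - 1) (derive1 f) v y * w 0 0
  + (mono1 (a - 2) (radial a f) v y * dotp (bar y) (bar w)
     + mono (a - 2) (radial a f) y * dotp (bar v) (bar w)).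

Definition mono3 a f t v w y : R :=
  mono2 (a - 1) (derive1 f) t v y * w 0 0
  + (mono2 (a - 2) (radial a f) t v y * dotp (bar y) (bar w)
     + mono1 (a - 2) (radial a f) v y * dotp (bar t) (bar w)
     + mono1 (a - 2) (radial a f) t y * dotp (bar v) (bar w)).

Lemma is_derive_mono a f y v : bar y != 0 -> (forall z, derivable f z 1) ->
  is_derive y v (mono a f) (mono1 a f v y).
Proof.
move=> y0 df; have u0 := enorm_gt0 y0.
have u0' : enorm (bar y) != 0 by rewrite gt_eqF.
have Hu := is_derive_comp1 (is_derive_enorm v y0) (is_derive_exprz a u0').
have Hz := is_derive_comp1 (is_derive_slope v y0) (derivableP (df _)).
apply: is_derive_eq (is_derive_mulf Hu Hz) _.
rewrite /mono1 /mono /radial !derive1E !expfzDr //.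
move: (enorm _) u0' => u u0'.
have -> : u ^ (- 1) = u^-1 by [].
have -> : u ^ (- 2) = (u ^+ 2)^-1 by [].
by field.
Qed.

Definition smooth1 (f : R -> R) := forall k z, derivable (derive1n k f) z 1.

Lemma smooth1_derivable f z : smooth1 f -> derivable f z 1.
Proof. by move=> sf; apply: (sf 0). Qed.
Arguments smooth1_derivable {f} z.

Lemma smooth1_derive f : smooth1 f -> smooth1 (derive1 f).
Proof. by move=> sf k z; rewrite -derive1Sn; apply: sf. Qed.

Lemma is_derive_radial a f (z : R) : smooth1 f ->
  is_derive z 1 (radial a f) (radial (a - 1) (derive1 f) z).
Proof.
move=> sf; have Hf := derivableP (smooth1_derivable z sf).
have Hf' := derivableP (smooth1_derivable z (smooth1_derive sf)).
have H := is_derive_subf (is_derive_mulf (is_derive_cst (a%:~R : R) z 1) Hf)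
  (is_derive_mulf (is_derive_id z 1) Hf').
apply: is_derive_eq H _.
by rewrite /radial !derive1E rmorphB /=; ring.
Qed.

(** Since [(a f - z f')' = (a - 1) f' - z f''], iterated derivatives of
    [radial a f] stay of the same form, whence [smooth1_radial]. *)
Lemma derive1_radial a f : smooth1 f ->
  derive1 (radial a f) = radial (a - 1) (derive1 f).
Proof.
move=> sf; apply/funext => z; rewrite derive1E.
exact: (@derive_val _ _ _ _ _ _ _ (is_derive_radial a z sf)).
Qed.

Lemma smooth1_radial a f : smooth1 f -> smooth1 (radial a f).
Proof.
move=> sf k z; elim: k a f sf z => [|k IH] a f sf z.
  exact: (@ex_derive _ _ _ _ _ _ _ (is_derive_radial a z sf)).
by rewrite derive1Sn derive1_radial //; apply: IH; apply: smooth1_derive.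
Qed.

Arguments smooth1_radial a {f}.

(** The iterated derivatives of [g] up to order three, as explicit functions on
    the region where the spatial part does not vanish. Each of them is
    differentiated there as a whole, which is what lets formulas for the first
    and second derivatives be substituted under the next derivative. *)
Record jet3 (g : V -> R) (g1 : V -> V -> R) (g2 : V -> V -> V -> R)
    (g3 : V -> V -> V -> V -> R) : Prop := Jet3 {
  jet1P : forall v y, bar y != 0 -> is_derive y v g (g1 v y);
  jet2P : forall v w y, bar y != 0 -> is_derive y v (g1 w) (g2 v w y);
  jet3P : forall t v w y, bar y != 0 -> is_derive y t (g2 v w) (g3 t v w y) }.

Lemma jet3_mono a f : smooth1 f ->
  jet3 (mono a f) (mono1 a f) (mono2 a f) (mono3 a f).
Proof.
have H1 b (h : R -> R) v y : smooth1 h -> bar y != 0 -> is_derive y v (mono b h) (mono1 b h v y).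
  by move=> sh y0; apply: is_derive_mono => // z; apply: smooth1_derivable.
have H2 b (h : R -> R) v w y : smooth1 h -> bar y != 0 ->
    is_derive y v (mono1 b h w) (mono2 b h v w y).
  move=> sh y0.
  have Ha := H1 (b - 1) _ v y (smooth1_derive sh) y0.
  have Hb := H1 (b - 2) _ v y (smooth1_radial b sh) y0.
  have H := is_derive_addf (is_derive_scalef (w 0 0) Ha)
    (is_derive_mulf Hb (is_derive_dotp_bar w y v)).
  have -> : mono1 b h w = (fun p => mono (b - 1) (derive1 h) p * w 0 0 +
       mono (b - 2) (radial b h) p * dotp (bar w) (bar p)).
    by apply/funext => p; rewrite [dotp _ (bar p)]dotpC.
  apply: is_derive_eq H _.
  by rewrite /mono2 ![dotp (bar w) _]dotpC; ring.
move=> sf; split=> [v y|v w y|t v w y]; [exact: H1|exact: H2|move=> y0].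
have Ha := H2 (a - 1) _ t v y (smooth1_derive sf) y0.
have sT := smooth1_radial a sf.
have Hb := H2 (a - 2) _ t v y sT y0.
have Hc := H1 (a - 2) _ t y sT y0.
have H := is_derive_addf (is_derive_scalef (w 0 0) Ha)
  (is_derive_addf (is_derive_mulf Hb (is_derive_dotp_bar w y t))
     (is_derive_scalef (dotp (bar v) (bar w)) Hc)).
have -> : mono2 a f v w = (fun p => mono1 (a - 1) (derive1 f) v p * w 0 0 +
     (mono1 (a - 2) (radial a f) v p * dotp (bar w) (bar p) +
      mono (a - 2) (radial a f) p * dotp (bar v) (bar w))).
  by apply/funext => p; rewrite [dotp _ (bar p)]dotpC.
apply: is_derive_eq H _.
by rewrite /mono3 ![dotp (bar w) _]dotpC; ring.
Qed.

Lemma jet3_linear x g g1 g2 g3 : jet3 g g1 g2 g3 ->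
  jet3 (fun y => dotp (bar x) (bar y) * g y)
   (fun v y => dotp (bar x) (bar y) * g1 v y + dotp (bar x) (bar v) * g y)
   (fun v w y => dotp (bar x) (bar y) * g2 v w y + dotp (bar x) (bar v) * g1 w y
      + dotp (bar x) (bar w) * g1 v y)
   (fun t v w y => dotp (bar x) (bar y) * g3 t v w y + dotp (bar x) (bar t) * g2 v w y
      + dotp (bar x) (bar v) * g2 t w y + dotp (bar x) (bar w) * g2 t v y).
Proof.
case=> H1 H2 H3; split=> [v y y0|v w y y0|t v w y y0].
- exact: is_derive_mulf (is_derive_dotp_bar x y v) (H1 v y y0).
- have := is_derive_addf (is_derive_mulf (is_derive_dotp_bar x y v) (H2 v w y y0))
    (is_derive_mulf (is_derive_cst (dotp (bar x) (bar w)) y v) (H1 v y y0)).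
  by rewrite mul0r addr0.
- have := is_derive_addf (is_derive_addf
     (is_derive_mulf (is_derive_dotp_bar x y t) (H3 t v w y y0))
     (is_derive_mulf (is_derive_cst (dotp (bar x) (bar v)) y t) (H2 t w y y0)))
    (is_derive_mulf (is_derive_cst (dotp (bar x) (bar w)) y t) (H2 t v y y0)).
  by rewrite !mul0r !addr0.
Qed.

Lemma jet3_scale (c : R) g g1 g2 g3 : jet3 g g1 g2 g3 ->
  jet3 (fun y => g y * c) (fun v y => g1 v y * c)
   (fun v w y => g2 v w y * c) (fun t v w y => g3 t v w y * c).
Proof.
case=> H1 H2 H3; split=> [v y y0|v w y y0|t v w y y0]; apply: is_derive_scalef.
- exact: H1.
- exact: H2.
- exact: H3.
Qed.

Lemma jet3_add g g1 g2 g3 h h1 h2 h3 : jet3 g g1 g2 g3 -> jet3 h h1 h2 h3 ->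
  jet3 (fun y => g y + h y) (fun v y => g1 v y + h1 v y)
   (fun v w y => g2 v w y + h2 v w y) (fun t v w y => g3 t v w y + h3 t v w y).
Proof.
case=> G1 G2 G3 [H1 H2 H3]; split=> [v y y0|v w y y0|t v w y y0];
  apply: is_derive_addf.
- exact: G1.
- exact: H1.
- exact: G2.
- exact: H2.
- exact: G3.
- exact: H3.
Qed.

Lemma continuous_normsq : continuous (fun y : V => dotp (bar y) (bar y)).
Proof.
move=> y; apply: differentiable_continuous.
have -> : (fun y : V => dotp (bar y) (bar y)) =
   \sum_(i < n) ((fun y : V => y 0 (lift ord0 i)) * (fun y : V => y 0 (lift ord0 i))).
  by apply/funext => y'; rewrite fct_sumE; apply: eq_bigr => i _; rewrite !mxE.
apply: differentiable_sum => i.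
by apply: differentiableM; apply: differentiable_coord.
Qed.

Lemma bar_neq0 y : (bar y != 0) = (0 < dotp (bar y) (bar y)).
Proof.
apply/idP/idP => [|H]; first exact: dotp_gt0.
by apply: contraTneq H => ->; rewrite dotp0 ltxx.
Qed.

Lemma open_bar_neq0 : open [set y : V | bar y != 0].
Proof.
have -> : [set y : V | bar y != 0] =
    (fun y : V => dotp (bar y) (bar y)) @^-1` [set r : R | 0 < r].
  by apply/seteqP; split=> y /=; rewrite bar_neq0.
apply: open_comp; last exact: open_gt.
by move=> y _; apply: continuous_normsq.
Qed.

(** The region is open, so equality on it passes to the derivatives at each
    order. *)
Lemma derive3_jet3 g h g1 g2 g3 : jet3 g g1 g2 g3 ->
  (forall y, bar y != 0 -> h y = g y) ->
  forall t v w y, bar y != 0 -> 'D_t ('D_v ('D_w h)) y = g3 t v w y.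
Proof.
case=> H1 H2 H3 hg t v w y y0.
have oU := open_bar_neq0.
have E1 : forall q, bar q != 0 -> 'D_w h q = g1 w q.
  move=> q q0; rewrite (derive_eq_on w oU (f := h) (g := g)) //.
  exact: (@derive_val _ _ _ _ _ _ _ (H1 w q q0)).
have E2 : forall q, bar q != 0 -> 'D_v ('D_w h) q = g2 v w q.
  move=> q q0; rewrite (derive_eq_on v oU E1) //.
  exact: (@derive_val _ _ _ _ _ _ _ (H2 v w q q0)).
rewrite (derive_eq_on t oU E2) //.
exact: (@derive_val _ _ _ _ _ _ _ (H3 t v w y y0)).
Qed.

End Calculus.

(** The recursive definitions are expanded for the use of [field]. The
    derivatives of [f] enter as separate functions [f1], [f2], [f3], so that they
    appear as [dz phi], [dz (dz phi)] and so on for [f = phi ^~ r]. *)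
Section ClosedForms.
Variables (R : realType) (n : nat).
Notation V := 'rV[R]_n.+1.
Variables (a : int) (f : R -> R) (t v w y : V).
Hypotheses (sf : smooth1 f) (y0 : bar y != 0).
Let u := enorm (bar y).
Let z := y 0 0 / u.
Let u0 : u != 0. Proof. by rewrite gt_eqF ?enorm_gt0. Qed.
Let c : R := a%:~R.
Variables f1 f2 f3 : R -> R.
Hypotheses (f1E : derive1 f = f1) (f2E : derive1 f1 = f2) (f3E : derive1 f2 = f3).
Let TE b (g : R -> R) p : radial b g p = b%:~R * g p - p * derive1 g p. Proof. by []. Qed.
Notation "<< p , q >>" := (dotp (bar p) (bar q)).

Let expN1 : u ^ (-1) = u^-1. Proof. by []. Qed.
Let int1 : (1 : int)%:~R = 1 :> R. Proof. by []. Qed.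
Let int2 : (2 : int)%:~R = 2 :> R. Proof. by []. Qed.
Let expN2 : u ^ (-2) = (u ^+ 2)^-1. Proof. by []. Qed.

Lemma mono1E : mono1 a f v y = u ^ a *
  (f1 z * v 0 0 / u + (c * f z - z * f1 z) * <<y, v>> / u ^+ 2).
Proof.
rewrite /mono1 /mono /radial -/u -/z !expfzDr // expN1 expN2 f1E -/c.
by field.
Qed.

Let q0 (k : R) := k * (k - 2) * f z - (2 * k - 3) * z * f1 z + z ^+ 2 * f2 z.

Lemma mono2E : mono2 a f v w y = u ^ a *
  (f2 z * v 0 0 * w 0 0 / u ^+ 2
   + ((c - 1) * f1 z - z * f2 z) * (v 0 0 * <<y, w>> + w 0 0 * <<y, v>>) / u ^+ 3
   + q0 c * <<y, v>> * <<y, w>> / u ^+ 4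
   + (c * f z - z * f1 z) * <<v, w>> / u ^+ 2).
Proof.
rewrite /mono2 /mono1 /mono !(TE, derive1_radial) //.
rewrite -/u -/z !expfzDr // expN1 expN2 !f1E !f2E !rmorphB /=
  int1 int2 -/c /q0.
by field.
Qed.

Lemma mono3E : mono3 a f t v w y = u ^ a *
  (f3 z * t 0 0 * v 0 0 * w 0 0 / u ^+ 3
   + ((c - 2) * f2 z - z * f3 z) / u ^+ 4 *
     (t 0 0 * v 0 0 * <<y, w>> + t 0 0 * w 0 0 * <<y, v>> + v 0 0 * w 0 0 * <<y, t>>)
   + ((c - 1) * (c - 3) * f1 z - (2 * c - 5) * z * f2 z + z ^+ 2 * f3 z) / u ^+ 5 *
     (t 0 0 * <<y, v>> * <<y, w>> + v 0 0 * <<y, t>> * <<y, w>>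
       + w 0 0 * <<y, t>> * <<y, v>>)
   + ((c - 1) * f1 z - z * f2 z) / u ^+ 3 *
     (t 0 0 * <<v, w>> + v 0 0 * <<t, w>> + w 0 0 * <<t, v>>)
   + ((c - 4) * q0 c - z * ((c - 1) * (c - 3) * f1 z - (2 * c - 5) * z * f2 z
       + z ^+ 2 * f3 z)) / u ^+ 6 * (<<y, t>> * <<y, v>> * <<y, w>>)
   + q0 c / u ^+ 4 *
     (<<t, v>> * <<y, w>> + <<t, w>> * <<y, v>> + <<v, w>> * <<y, t>>)).
Proof.
have sf1 := smooth1_derive sf; have sf2 := smooth1_derive sf1.
have sT := smooth1_radial (a := a) sf; have sT1 := smooth1_radial (a := a - 1) sf1.
rewrite /mono3 /mono2 /mono1 /mono !(TE, derive1_radial) //.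
rewrite -/u -/z !expfzDr // expN1 expN2 !f1E !f2E !f3E.
rewrite !rmorphB /= int1 int2 -/c /q0.
by field.
Qed.
End ClosedForms.

(** A definitional equality, stated so that the closed forms above can be
    instantiated with iterated [dz]. *)
Lemma slice_derive (R : realType) (f : R -> R -> R) (r : R) :
  derive1 (f ^~ r) = dz f ^~ r.
Proof. by []. Qed.

(** * Linear algebra *)

Section LinearAlgebra.
Variables (R : realType).

Lemma linformE m (l : 'rV[R]_m -> R) v : linform l ->
  l v = \sum_(A < m) l (delta_mx 0 A) * v 0 A.
Proof.
move=> ll; have l0 : l 0 = 0.
  have := ll (-1) 0 0; rewrite scaler0 add0r mulN1r addNr => ->; done.
rewrite [in LHS](row_sum_delta v).
apply: (big_ind2 (fun q p => l q = p)) => // [q p q' p' <- <-|A _].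
  by have := ll 1 q' q; rewrite scale1r mul1r.
by have := ll (v 0 A) 0 (delta_mx 0 A); rewrite l0 !addr0 mulrC.
Qed.

Lemma bilinear_gram m (q : 'rV[R]_m -> 'rV[R]_m -> R) (v w : 'rV[R]_m) :
  (forall w, linform (q ^~ w)) -> (forall v, linform (q v)) ->
  (v *m (\matrix_(A, B) q (delta_mx 0 B) (delta_mx 0 A)) *m w^T) 0 0 = q w v.
Proof.
move=> ql qr; rewrite mxE (linformE w (ql v)); apply: eq_bigr => B _.
rewrite !mxE (linformE v (qr _)); congr (_ * _); apply: eq_bigr => A _.
by rewrite !mxE mulrC.
Qed.

(** A row in the kernel of [g] would be isotropic. *)
Lemma posdef_unitmx m (g : 'M[R]_m) :
  (forall v : 'rV[R]_m, v != 0 -> 0 < (v *m g *m v^T) 0 0) -> g \in unitmx.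
Proof.
move=> gpos; rewrite -row_free_unit -kermx_eq0; apply/eqP/row_matrixP => i.
rewrite row0; apply/eqP; apply: contraT => /gpos.
by rewrite -row_mul mulmx_ker row0 mul0mx mxE ltxx.
Qed.

(** The spray is defined through the inverse of the fundamental tensor; it is
    found by checking a candidate in the linear system. *)
Lemma invmx_solve m (g : 'M[R]_m) (b G : 'I_m -> R) (C : 'I_m) :
  g \in unitmx -> (forall A, \sum_B g A B * G B = b A) ->
  \sum_A invmx g C A * b A = G C.
Proof.
move=> gu gG.
have E : g *m (\col_B G B) = \col_A b A.
  by apply/colP => A; rewrite !mxE -gG; apply: eq_bigr => B _; rewrite mxE.
have := congr1 (fun M : 'cV_m => M C 0) (mulKmx gu (\col_B G B)).
by rewrite E !mxE => <-; apply: eq_bigr => A _; rewrite mxE.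
Qed.
End LinearAlgebra.

Section Splitting.
Variables (R : realType) (n : nat).
Notation V := 'rV[R]_n.+1.

Definition mkvec (a : R) (b : 'rV[R]_n) : V :=
  \row_A (if unlift ord0 A is Some i then b 0 i else a).

Lemma mkvec0 a b : mkvec a b 0 0 = a.
Proof. by rewrite mxE -[0]/(ord0 : 'I_n.+1) unlift_none. Qed.

Lemma bar_mkvec a b : bar (mkvec a b) = b.
Proof. by apply/rowP => i; rewrite !mxE liftK. Qed.

Lemma mkvec_coord a b A : mkvec a b 0 A =
  a * (delta_mx 0 A : V) 0 0 + dotp b (bar (delta_mx 0 A)).
Proof.
rewrite mxE; case: unliftP => [i ->|->].
  by rewrite bar_eS dotp_e mxE /= mulr0 add0r.
by rewrite bar_e0 dotp0 mxE !eqxx mulr1 addr0.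
Qed.

Lemma mkvec_neq0 a b : (a != 0) || (b != 0) -> mkvec a b != 0.
Proof.
apply: contraTneq => ab0; rewrite negb_or !negbK.
have -> : a = 0 by rewrite -(mkvec0 a b) ab0 mxE.
have -> : b = 0 by rewrite -(bar_mkvec a b) ab0; apply/rowP => i; rewrite !mxE.
by rewrite !eqxx.
Qed.

Lemma mkvecM h a b a' b' :
  mkvec (h * a + a') (h *: b + b') = h *: mkvec a b + mkvec a' b'.
Proof. by apply/rowP => A; rewrite !mxE; case: unliftP => * /=; rewrite ?mxE. Qed.

Lemma exists_orthogonal (v : 'rV[R]_n) : (2 <= n)%N -> v != 0 ->
  exists2 w, w != 0 & dotp v w = 0.
Proof.
move=> n2 v0.
have [i vi0] : exists i, v 0 i != 0.
  apply/existsP; apply: contraNT v0; rewrite negb_exists => /forallP H.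
  by apply/eqP/rowP => i; apply/eqP; rewrite mxE -[_ == _]negbK.
have [j ji] : exists j : 'I_n, j != i.
  have [j0 j1] : (0 < n)%N /\ (1 < n)%N by split=> //; apply: ltnW.
  have [i0|i0] := eqVneq (i : nat) 0%N.
    by exists (Ordinal j1); apply/eqP => /(congr1 val) /=; rewrite i0.
  by exists (Ordinal j0); rewrite eq_sym.
exists (v 0 j *: delta_mx 0 i + - v 0 i *: delta_mx 0 j).
  apply: contraNneq vi0 => /(congr1 (fun w : 'rV_n => w 0 j)).
  rewrite !mxE !eqxx (negPf ji) /= mulr0 add0r mulr1 => /eqP.
  by rewrite oppr_eq0.
by rewrite dotpC dotpDl !dotpZl ![dotp (delta_mx _ _) _]dotpC !dotp_e; ring.
Qed.
End Splitting.

(** * Functions of z and r *)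

Section Strip.
Variables (R : realType) (rho : R).
Implicit Types (f g : R -> R -> R) (z r : R).

Definition strip : set (R * R) := [set p | 0 < p.2 < rho].

Lemma open_strip : open strip.
Proof.
have -> : strip = snd @^-1` [set` `]0, rho[].
  by apply/seteqP; split=> p /=; rewrite in_itv.
apply: open_comp; last exact: itv_open.
by move=> p _; apply: cvg_snd.
Qed.

Definition smooth2 (f : R -> R -> R) : Prop :=
  dsmooth strip (fun p => f p.1 p.2).

Lemma dzE (f : R -> R -> R) p : dz f p.1 p.2 = 'D_((1, 0) : R * R) (fun p => f p.1 p.2) p.
Proof.
rewrite /dz /derive1 /derive; set k1 := fun h => _; set k2 := fun h => _.
suff -> : k1 = k2 by [].
by apply/funext => h; rewrite /k1 /k2 /= [h *: 1]mulr1 scaler0 add0r.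
Qed.

Lemma drE (f : R -> R -> R) p : dr f p.1 p.2 = 'D_((0, 1) : R * R) (fun p => f p.1 p.2) p.
Proof.
rewrite /dr /derive1 /derive; set k1 := fun h => _; set k2 := fun h => _.
suff -> : k1 = k2 by [].
by apply/funext => h; rewrite /k1 /k2 /= [h *: 1]mulr1 scaler0 add0r.
Qed.

Lemma smooth2_dz f : smooth2 f -> smooth2 (dz f).
Proof.
move=> sf; rewrite /smooth2 (funext (dzE f)); exact: dsmooth_derive.
Qed.

Lemma smooth2_dr f : smooth2 f -> smooth2 (dr f).
Proof.
move=> sf; rewrite /smooth2 (funext (drE f)); exact: dsmooth_derive.
Qed.

Lemma is_derive_dz f z r : smooth2 f -> 0 < r < rho ->
  is_derive z 1 (f ^~ r) (dz f z r).
Proof.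
move=> sf hr; rewrite /dz derive1E; apply: derivableP.
have := (derive_affine (A := fun z : R => (z, r) : R * R) (L := fun z : R => (z, 0) : R * R)
  (fun p => f p.1 p.2) z 1 _).2; apply.
  by move=> h q w; apply/pair_equal_spec; rewrite /= scaler0 add0r.
exact: dsmooth_derivable sf _.
Qed.

Lemma is_derive_dr f z r : smooth2 f -> 0 < r < rho ->
  is_derive r 1 (f z) (dr f z r).
Proof.
move=> sf hr; rewrite /dr derive1E; apply: derivableP.
have := (derive_affine (A := fun r : R => (z, r) : R * R) (L := fun r : R => (0, r) : R * R)
  (fun p => f p.1 p.2) r 1 _).2; apply.
  by move=> h q w; apply/pair_equal_spec; rewrite /= scaler0 add0r.
exact: dsmooth_derivable sf _.
Qed.

(** The derivative of the slice of [f] is the slice of [dz f], so the induction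
    on the order of derivation runs over all smooth [f]. *)
Lemma smooth1_slice f r : smooth2 f -> 0 < r < rho -> smooth1 (f ^~ r).
Proof.
move=> sf hr k; elim: k f sf => [|k IH] f sf z.
  exact: (@ex_derive _ _ _ _ _ _ _ (is_derive_dz z sf hr)).
by rewrite derive1Sn; apply: (IH (dz f)); apply: smooth2_dz.
Qed.

Lemma smooth2_cst (c : R) : smooth2 (fun _ _ => c).
Proof. exact: dsmooth_cst open_strip. Qed.

Lemma smooth2_z : smooth2 (fun z _ => z).
Proof. by apply: (@dsmooth_linear _ _ strip (fun p : R * R => p.1)) => //; exact: open_strip. Qed.

Lemma smooth2_r : smooth2 (fun _ r => r).
Proof. by apply: (@dsmooth_linear _ _ strip (fun p : R * R => p.2)) => //; exact: open_strip. Qed.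

Lemma smooth2D f g : smooth2 f -> smooth2 g -> smooth2 (fun z r => f z r + g z r).
Proof. exact: dsmoothD open_strip. Qed.

Lemma smooth2M f g : smooth2 f -> smooth2 g -> smooth2 (fun z r => f z r * g z r).
Proof. exact: dsmoothM open_strip. Qed.

Lemma smooth2B f g : smooth2 f -> smooth2 g -> smooth2 (fun z r => f z r - g z r).
Proof.
move=> sf sg.
have -> : (fun z r => f z r - g z r) = (fun z r => f z r + -1 * g z r).
  by apply/funext => z; apply/funext => r; rewrite mulN1r.
by apply: smooth2D sf _; apply: smooth2M sg; apply: smooth2_cst.
Qed.

Lemma smooth2_div f g : smooth2 f -> smooth2 g ->
  (forall z r, 0 < r < rho -> g z r != 0) -> smooth2 (fun z r => f z r / g z r).
Proof.
move=> sf sg g0.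
have sV : smooth2 (fun z r => (g z r)^-1).
  by apply: (dsmoothV (f := fun p => g p.1 p.2) open_strip sg) => p; apply: g0.
exact: (smooth2M sf sV).
Qed.

End Strip.

(** * The coefficients of the spray *)

(** Four times the determinant of the fundamental tensor on the plane spanned
    by [e_0] and a spatial unit vector [bar y]; the denominator of [U] and [V]. *)
Definition Delta (R : realType) (f : R -> R -> R) (z r : R) : R :=
  2 * f z r * dz (dz f) z r - dz f z r ^+ 2.

Section Coefficients.
Variables (R : realType) (rho : R) (phi : R -> R -> R).
Hypothesis sphi : smooth2 rho phi.
Hypothesis Delta0 : forall z r, 0 < r < rho -> Delta phi z r != 0.
Hypothesis Omega0 : forall z r, 0 < r < rho -> Omega phi z r != 0.

Let mul2r_neq0 c r : 0 < r < rho -> c != 0 -> 2 * r * c != 0.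
Proof.
move=> /andP[r0 _] c0; rewrite !mulf_neq0 ?pnatr_eq0 //.
by rewrite gt_eqF.
Qed.

Let s1 := smooth2_dz sphi.
Let s2 := smooth2_dz s1.
Let sr := smooth2_dr sphi.
Let s1r := smooth2_dr s1.
Let sz := @smooth2_z R rho.
Let s2r : smooth2 rho (fun _ r => 2 * r).
Proof. by apply: smooth2M (@smooth2_r R rho); apply: smooth2_cst. Qed.

Let smul2 f : smooth2 rho f -> smooth2 rho (fun z r => 2 * f z r).
Proof. by apply: smooth2M; apply: smooth2_cst. Qed.

Lemma smooth2_Omega : smooth2 rho (Omega phi).
Proof. exact: smooth2B (smul2 sphi) (smooth2M sz s1). Qed.

Lemma smooth2_Delta : smooth2 rho (Delta phi).
Proof. exact: smooth2B (smooth2M (smul2 sphi) s2) (smooth2M s1 s1). Qed.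

Lemma smooth2_Ucoef : smooth2 rho (Ucoef phi).
Proof.
apply: (smooth2_div (smooth2B (smooth2M (smul2 sphi) s1r) (smooth2M s1 sr))
   (smooth2M s2r smooth2_Delta)) => z r hr.
exact/(mul2r_neq0 hr)/Delta0.
Qed.

Lemma smooth2_Vcoef : smooth2 rho (Vcoef phi).
Proof.
apply: (smooth2_div (smooth2B (smooth2M sr s2) (smooth2M s1 s1r))
   (smooth2M s2r smooth2_Delta)) => z r hr.
exact/(mul2r_neq0 hr)/Delta0.
Qed.

Lemma smooth2_Wcoef : smooth2 rho (Wcoef phi).
Proof.
apply: (smooth2_div sr (smooth2M s2r smooth2_Omega)) => z r hr.
exact/(mul2r_neq0 hr)/Omega0.
Qed.

Lemma smooth2_Ecoef : smooth2 rho (Ecoef phi).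
Proof. exact: smooth2D smooth2_Ucoef (smooth2M sz smooth2_Vcoef). Qed.

Lemma smooth2_Hcoef : smooth2 rho (Hcoef phi).
Proof. exact: smooth2D smooth2_Vcoef smooth2_Wcoef. Qed.
End Coefficients.

(** * Spray and Landsberg curvature of F^2 = u^2 phi(z, r) *)

(** Regularity of [phi] and the formula for the square of [F] are hypotheses
    here, because they are used for two functions: first for a profile read off
    from [F], then for [phi] itself. *)
Section SphericalMetric.
Variables (R : realType) (n : nat) (rho : R).
Notation V := 'rV[R]_n.+1.
Variables (F : V -> V -> R) (phi : R -> R -> R).
Hypothesis n2 : (2 <= n)%N.
Hypothesis sphi : smooth2 rho phi.
Hypothesis posdef : forall x y v : V, RxBall n rho x -> y != 0 -> v != 0 ->
  0 < (v *m half_hessian_sq (F x) y *m v^T) 0 0.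
Hypothesis FsqE : forall x y : V, 0 < enorm (bar x) < rho -> bar y != 0 ->
  Fsq F x y = mono 2 (phi ^~ (enorm (bar x))) y.
Implicit Types (x y v w t : V).
Notation "<< p , q >>" := (dotp (bar p) (bar q)).
Notation e_ A := (delta_mx 0 A : V).

Lemma dy_FsqE A x y : 0 < enorm (bar x) < rho -> bar y != 0 ->
  dy A (Fsq F) x y = mono1 2 (phi ^~ (enorm (bar x))) (e_ A) y.
Proof.
move=> hx y0; rewrite /dy /pd.
rewrite (derive_eq_on (e_ A) (@open_bar_neq0 R n) (fun y => FsqE hx)) //.
exact: (@derive_val _ _ _ _ _ _ _ (jet1P (jet3_mono n 2 (smooth1_slice sphi hx)) _ y0)).
Qed.

Lemma half_hessian_sqE x y : 0 < enorm (bar x) < rho -> bar y != 0 ->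
  half_hessian_sq (F x) y =
  \matrix_(A, B) (2^-1 * mono2 2 (phi ^~ (enorm (bar x))) (e_ B) (e_ A) y).
Proof.
move=> hx y0; apply/matrixP => A B; rewrite !mxE; congr (_ * _).
rewrite {1}/pd.
rewrite (derive_eq_on (e_ B) (@open_bar_neq0 R n) (fun y => @dy_FsqE A x y hx)) //.
exact: (@derive_val _ _ _ _ _ _ _ (jet2P (jet3_mono n 2 (smooth1_slice sphi hx)) _ _ y0)).
Qed.

(** The fundamental tensor as a bilinear form, for the slice [f] of [phi]. *)
Definition hess f y v w : R := 2^-1 * mono2 2 f v w y.

Lemma linform_hess f y : smooth1 f -> bar y != 0 ->
  (forall w, linform ((hess f y) ^~ w)) * (forall v, linform (hess f y v)).
Proof.
move=> sf y0; have u0 : enorm (bar y) != 0 by rewrite gt_eqF ?enorm_gt0.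
by split=> w h q p; rewrite /hess !(mono2E _ _ _ sf y0 erefl erefl) !barD !barZ
  ![dotp (bar y) (_ + _)]dotpC ?[dotp (bar w) (_ + _)]dotpC !dotpDl !dotpZl
  ![dotp _ (bar y)]dotpC ?[dotp _ (bar w)]dotpC !mxE; field.
Qed.

Lemma hess_gt0 x y v : 0 < enorm (bar x) < rho -> bar y != 0 -> v != 0 ->
  0 < hess (phi ^~ (enorm (bar x))) y v v.
Proof.
move=> hx y0 v0; have [l1 l2] := linform_hess (smooth1_slice sphi hx) y0.
have hxr : RxBall n rho x by case/andP: hx.
have yn0 : y != 0 by apply: contraNneq y0 => ->; apply/eqP/rowP => i; rewrite !mxE.
have := posdef hxr yn0 v0.
by rewrite half_hessian_sqE // (bilinear_gram v v l1 l2).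
Qed.

(** Positivity of [Omega] and [Delta] concerns all [(z, r)], whereas the metric
    only speaks of points of the tangent bundle. *)
Lemma exists_point (r z : R) : 0 < r < rho ->
  exists x y, [/\ enorm (bar x) = r, bar y != 0, enorm (bar y) = 1 & y 0 0 = z].
Proof.
move=> /andP[r0 _].
pose i0 : 'I_n := Ordinal (ltnW n2).
have d1 : dotp (delta_mx 0 i0 : 'rV[R]_n) (delta_mx 0 i0) = 1.
  by rewrite dotp_e mxE !eqxx.
exists (mkvec 0 (r *: delta_mx 0 i0)), (mkvec z (delta_mx 0 i0)).
rewrite !bar_mkvec mkvec0 /enorm dotpZl dotpZr d1 mulr1 sqrtr1 -expr2 sqrtr_sqr.
rewrite gtr0_norm //; split=> //.
by apply: contraTneq isT => H; move: d1; rewrite H dotp0 => /esym/eqP; rewrite oner_eq0.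
Qed.

(** On a spatial vector [w] orthogonal to [bar y] the fundamental tensor is
    [Omega <w, w> / 2]; such a [w] exists because [n >= 2]. *)
Lemma Omega_gt0 z r : 0 < r < rho -> 0 < Omega phi z r.
Proof.
move=> hr; have [x [y [xr y0 u1 yz]]] := exists_point z hr.
have [w w0 yw] := exists_orthogonal n2 y0.
have hx : 0 < enorm (bar x) < rho by rewrite xr.
have v0 : mkvec 0 w != 0 by apply: mkvec_neq0; rewrite w0 orbT.
have := hess_gt0 hx y0 v0; have := dotp_gt0 w0.
rewrite /hess (mono2E _ _ _ (smooth1_slice sphi hx) y0 (slice_derive _ _) (slice_derive _ _)).
rewrite xr bar_mkvec mkvec0 yw u1 yz divr1 => ww.
rewrite /Omega.
have -> : (2 : int)%:~R = 2 :> R by [].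
set X := (X in 0 < X -> _).
have -> : X = (2^-1 * dotp w w) * (2 * phi z r - z * dz phi z r) by rewrite /X exp1rz; field.
by rewrite pmulr_rgt0 // mulr_gt0 // invr_gt0.
Qed.

(** On the plane spanned by [e_0] and [bar y] the fundamental tensor is half of
    the form [A a^2 + 2 B a b + C b^2] with [A C - B^2 = Delta]. Its value at
    [(1, 0)] gives [0 < A], and its value at [(-B, A)] is [A (A C - B^2)]. *)
Lemma Delta_gt0 z r : 0 < r < rho -> 0 < Delta phi z r.
Proof.
move=> hr; have [x [y [xr y0 u1 yz]]] := exists_point z hr.
have hx : 0 < enorm (bar x) < rho by rewrite xr.
have yy : dotp (bar y) (bar y) = 1 by rewrite enorm_sq u1 expr1n.
pose p := phi z r; pose p1 := dz phi z r; pose p2 := dz (dz phi) z r.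
have H a b : (a != 0) || (b != 0) ->
    0 < p2 * a ^+ 2 + 2 * (p1 - z * p2) * a * b + (2 * p - 2 * z * p1 + z ^+ 2 * p2) * b ^+ 2.
  move=> ab; have v0 : mkvec a (b *: bar y) != 0.
    by apply: mkvec_neq0; rewrite scaler_eq0 (negPf y0) orbF.
  have := hess_gt0 hx y0 v0.
  rewrite /hess (mono2E _ _ _ (smooth1_slice sphi hx) y0 (slice_derive _ _) (slice_derive _ _)).
  rewrite xr bar_mkvec mkvec0 !dotpZl !dotpZr yy u1 yz divr1.
  have -> : (2 : int)%:~R = 2 :> R by [].
  rewrite exp1rz -/p -/p1 -/p2.
  set X := (X in 0 < X -> _); set Y := (Y in _ -> 0 < Y).
  have -> : Y = 2 * X by rewrite /X /Y; field.
  by move=> X0; rewrite mulr_gt0.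
have p20 : 0 < p2.
  by have := H 1 0; rewrite oner_eq0 => /(_ isT); rewrite expr1n expr0n /= !mulr0 !addr0 mulr1.
have := H (- (p1 - z * p2)) p2; rewrite (gt_eqF p20) orbT => /(_ isT).
set X := (X in 0 < X -> _).
have -> : X = p2 * Delta phi z r by rewrite /X /Delta -/p -/p1 -/p2; ring.
by rewrite pmulr_rgt0.
Qed.

Lemma open_shell : open [set x : V | 0 < enorm (bar x) < rho].
Proof.
have -> : [set x : V | 0 < enorm (bar x) < rho] =
    (fun x : V => Num.sqrt (dotp (bar x) (bar x))) @^-1` [set` `]0, rho[].
  by apply/seteqP; split=> p /=; rewrite in_itv.
apply: open_comp; last exact: itv_open.
by move=> x _; apply: continuous_comp; [exact: continuous_normsq|exact: sqrt_continuous].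
Qed.

(** The base point enters only through [r], whose derivative is [<x, v> / r]. *)
Lemma is_derive_base f z x v : smooth2 rho f -> 0 < enorm (bar x) < rho ->
  is_derive x v (fun x => f z (enorm (bar x)))
    (dr f z (enorm (bar x)) * (<<x, v>> / enorm (bar x))).
Proof.
move=> sf hx; have x0 : bar x != 0.
  by apply: contraTneq hx => ->; rewrite /enorm dotp0 sqrtr0 ltxx.
exact: is_derive_comp1 (is_derive_enorm v x0) (is_derive_dr z sf hx).
Qed.

Section AtPoint.
Variables (x y : V).
Hypotheses (hx : 0 < enorm (bar x) < rho) (y0 : bar y != 0).
Let r := enorm (bar x).
Let u := enorm (bar y).
Let z := y 0 0 / u.
Let u0 : u != 0. Proof. by rewrite gt_eqF ?enorm_gt0. Qed.
Let int2 : (2 : int)%:~R = 2 :> R. Proof. by []. Qed.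

(** The first derivative of the square of [F]: its components are
    [u phi_z] along [e_0] and [Omega y^i] along [e_i]. *)
Lemma mono1_FsqE x' v :
  mono1 2 (phi ^~ (enorm (bar x'))) v y =
  dz phi z (enorm (bar x')) * (u * v 0 0)
  + Omega phi z (enorm (bar x')) * <<y, v>>.
Proof.
rewrite (mono1E _ _ y0 (slice_derive _ _)) -/u -/z int2 /Omega.
have -> : u ^ 2 = u ^+ 2 by [].
by field.
Qed.

Lemma dx_dy_FsqE A B : dx B (dy A (Fsq F)) x y =
  (dr (dz phi) z r * (u * (e_ A) 0 0) + dr (Omega phi) z r * <<y, e_ A>>)
  * <<x, e_ B>> / r.
Proof.
rewrite /dx /pd.
rewrite (derive_eq_on (g := fun x' => dz phi z (enorm (bar x')) * (u * (e_ A) 0 0)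
    + Omega phi z (enorm (bar x')) * <<y, e_ A>>) (e_ B) open_shell) //; last first.
  by move=> x' hx'; rewrite dy_FsqE // mono1_FsqE.
have H1 := is_derive_base z (e_ B) (smooth2_dz sphi) hx.
have H2 := is_derive_base z (e_ B) (smooth2_Omega sphi) hx.
rewrite (@derive_val _ _ _ _ _ _ _
  (is_derive_addf (is_derive_scalef _ H1) (is_derive_scalef _ H2))).
by rewrite -/r; ring.
Qed.

Lemma dr_OmegaE : dr (Omega phi) z r = 2 * dr phi z r - z * dr (dz phi) z r.
Proof.
have H1 := is_derive_dr z sphi hx.
have H2 := is_derive_dr z (smooth2_dz sphi) hx.
rewrite {1}/dr derive1E; apply: derive_val.
Qed.

Lemma dx_FsqE A : dx A (Fsq F) x y = u ^+ 2 * dr phi z r * <<x, e_ A>> / r.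
Proof.
rewrite /dx /pd.
rewrite (derive_eq_on (g := fun x' => phi z (enorm (bar x')) * u ^+ 2) (e_ A) open_shell) //;
  last first.
  by move=> x' hx'; rewrite FsqE // /mono -/u -/z mulrC.
have H1 := is_derive_base z (e_ A) sphi hx.
rewrite (@derive_val _ _ _ _ _ _ _ (is_derive_scalef _ H1)).
by rewrite -/r; ring.
Qed.

(** The spray coefficients [G^0 = u p E] and [G^i = p H y^i - u^2 W x^i], with
    [p = <x, y>]; the factors [mono] carry the powers of [u]. *)
Definition spray_vec x y : V :=
  mkvec (<<x, y>> * mono 1 (Ecoef phi ^~ (enorm (bar x))) y)
    ((<<x, y>> * mono 0 (Hcoef phi ^~ (enorm (bar x))) y) *: bar y
     + - mono 2 (Wcoef phi ^~ (enorm (bar x))) y *: bar x).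

(** The system for the spray. Its part along [bar x] determines [W]; the parts
    along [e_0] and [bar y] form a system with determinant [Delta], which
    determines [E] and [V]. *)
Lemma spray_vec_eq w :
  4 * hess (phi ^~ r) y (spray_vec x y) w =
  (dr (dz phi) z r * (u * w 0 0) + dr (Omega phi) z r * <<y, w>>) * <<x, y>> / r
  - u ^+ 2 * dr phi z r * <<x, w>> / r.
Proof.
have D0 := lt0r_neq0 (Delta_gt0 z hx).
have O0 := lt0r_neq0 (Omega_gt0 z hx).
have r0 : r != 0 by rewrite gt_eqF //; case/andP: hx.
rewrite /hess (mono2E _ _ _ (smooth1_slice sphi hx) y0 (slice_derive _ _) (slice_derive _ _)).
rewrite /spray_vec bar_mkvec mkvec0 ![dotp (bar y) (_ + _)]dotpC !dotpDl !dotpZl.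
rewrite ![dotp (bar x) (bar y)]dotpC -/r /mono -/u -/z dr_OmegaE int2.
rewrite enorm_sq -/u expr1z expr0z.
have -> : u ^ 2 = u ^+ 2 by [].
rewrite /Hcoef /Ecoef /Ucoef /Vcoef /Wcoef.
move: D0 O0; rewrite /Delta /Omega -/r.
move: (phi z r) (dz phi z r) (dz (dz phi) z r) (dr phi z r) (dr (dz phi) z r) => p p1 p2 pr p1r.
move=> D0 O0.
by field; rewrite r0 u0 O0 D0.
Qed.

Lemma spray_vecE C : spray F C x y = spray_vec x y 0 C.
Proof.
have [l1 l2] := linform_hess (smooth1_slice sphi hx) y0.
have gE : half_hessian_sq (F x) y =
    \matrix_(A, B) hess (phi ^~ r) y (e_ B) (e_ A)
  by rewrite half_hessian_sqE.
have gu : half_hessian_sq (F x) y \in unitmx.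
  have hxr : RxBall n rho x by case/andP: hx.
  apply: posdef_unitmx => v v0; apply: posdef => //.
  by apply: contraNneq y0 => ->; apply/eqP/rowP => i; rewrite !mxE.
rewrite /spray -[RHS](mulKf (_ : 4 != 0)) ?pnatr_eq0 //; congr (_ * _).
apply: (invmx_solve (G := fun C => 4 * spray_vec x y 0 C)) => // A.
have -> : \sum_(B < n.+1) dx B (dy A (Fsq F)) x y * y 0 B =
    (dr (dz phi) z r * (u * (e_ A) 0 0) + dr (Omega phi) z r * <<y, e_ A>>)
    * <<x, y>> / r.
  set K : R := (X in X * _ / r).
  rewrite [RHS](@linformE _ _ (fun q : V => K * <<x, q>> / r)).
    by apply: eq_bigr => B _; rewrite dx_dy_FsqE.
  by move=> h q w; rewrite barD barZ dotpC dotpDl dotpZl !(dotpC _ (bar x)); ring.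
rewrite dx_FsqE -spray_vec_eq [in RHS](linformE (spray_vec x y) (l1 _)) mulr_sumr.
by apply: eq_bigr => B _; rewrite /fundamental_tensor gE mxE; ring.
Qed.

End AtPoint.

(** Second and third derivatives of [<x, y> u^a f(z)], by the Leibniz rule; a
    linear form has no second derivative. *)
Definition lin_mono2 x a f v w y : R := <<x, y>> * mono2 a f v w y
  + <<x, v>> * mono1 a f w y + <<x, w>> * mono1 a f v y.

Definition lin_mono3 x a f t v w y : R := <<x, y>> * mono3 a f t v w y
  + <<x, t>> * mono2 a f v w y + <<x, v>> * mono2 a f t w y + <<x, w>> * mono2 a f t v y.

(** The first derivative of the square of [F] is a linear form, so contracting it
    with the third derivatives of the spray amounts to evaluating it at the
    vector [M] that collects them. In [G^i = p H y^i - u^2 W x^i] the factor [y^i]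
    is linear, which is where the products of [lin_mono2] with [<y, t>], [<y, v>]
    and [<y, w>] come from. *)
Lemma landsberg_directional x y A B C :
    0 < enorm (bar x) < rho -> bar y != 0 ->
  let r := enorm (bar x) in let u := enorm (bar y) in let z := y 0 0 / u in
  let E := Ecoef phi ^~ r in let H := Hcoef phi ^~ r in let W := Wcoef phi ^~ r in
  let t := e_ A in let v := e_ B in let w := e_ C in
  landsberg F A B C x y = - 4^-1 *
    (dz phi z r * u * lin_mono3 x 1 E t v w y + Omega phi z r *
     (u ^+ 2 * lin_mono3 x 0 H t v w y
      + lin_mono2 x 0 H v w y * <<y, t>> + lin_mono2 x 0 H t w y * <<y, v>>
      + lin_mono2 x 0 H t v y * <<y, w>> - <<x, y>> * mono3 2 W t v w y)).
Proof.
move=> hx y0 r u z E H W t v w.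
have D0 z' r' (hr : 0 < r' < rho) := lt0r_neq0 (Delta_gt0 z' hr).
have O0 z' r' (hr : 0 < r' < rho) := lt0r_neq0 (Omega_gt0 z' hr).
have jE := jet3_linear x (jet3_mono n 1 (smooth1_slice (smooth2_Ecoef sphi D0) hx)).
have jH := jet3_linear x (jet3_mono n 0 (smooth1_slice (smooth2_Hcoef sphi D0 O0) hx)).
have jW := jet3_mono n 2 (smooth1_slice (smooth2_Wcoef sphi O0) hx).
(* [M 0 D] is the third derivative of [G^D] along [w], [v] and [t]. *)
pose M : V := mkvec (lin_mono3 x 1 E t v w y)
  (lin_mono3 x 0 H t v w y *: bar y + (lin_mono2 x 0 H v w y *: bar t +
   (lin_mono2 x 0 H t w y *: bar v + (lin_mono2 x 0 H t v y *: bar w +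
    - mono3 2 W t v w y *: bar x)))).
have third D : 'D_t ('D_v ('D_w (spray F D x))) y = M 0 D.
  have j := jet3_add (jet3_scale ((e_ D) 0 0) jE)
    (jet3_add (jet3_linear (e_ D) jH) (jet3_scale (- <<x, e_ D>>) jW)).
  rewrite (derive3_jet3 j) //; last first.
    move=> q q0; rewrite spray_vecE // /spray_vec mkvec_coord dotpDl !dotpZl.
    by rewrite ![dotp _ (bar (e_ D))]dotpC -/r; ring.
  rewrite /M mkvec_coord !dotpDl !dotpZl ![dotp _ (bar (e_ D))]dotpC.
  rewrite /lin_mono3 /lin_mono2 -/r -/E -/H -/W.
  move: (mono2 1 E) (mono3 1 E) (mono1 0 H) (mono2 0 H) (mono3 0 H) (mono3 2 W).
  by move=> *; ring.
have dlin : linform (fun q : V => dz phi z r * (u * q 0 0) + Omega phi z r * <<y, q>>).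
  by move=> h q q'; rewrite barD barZ dotpC dotpDl dotpZl !mxE !(dotpC _ (bar y)); ring.
rewrite /landsberg; congr (_ * _).
transitivity (\sum_(D < n.+1) (dz phi z r * (u * (e_ D) 0 0) + Omega phi z r * <<y, e_ D>>)
   * M 0 D).
  apply: eq_bigr => D _; congr (_ * _); last exact: third.
  by rewrite dy_FsqE // mono1_FsqE.
rewrite -(linformE M dlin) /M mkvec0 bar_mkvec.
rewrite ![dotp (bar y) (_ + _)]dotpC !dotpDl !dotpZl enorm_sq -/u.
rewrite ![dotp _ (bar y)]dotpC.
by move: (lin_mono2 x 0 H) (lin_mono3 x 0 H) (lin_mono3 x 1 E) (mono3 2 W) => *; ring.
Qed.
End SphericalMetric.

(** * Regularity and positivity of phi *)

(** The square root truncates negative values, so [F] only gives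
    [F^2 = u^2 max(phi, 0)] at first. The function [profile] is [max(phi, 0)] read
    off along a fixed unit vector [d], and is smooth because [F] is. *)
Section Profile.
Variables (R : realType) (n : nat) (rho : R).
Notation V := 'rV[R]_n.+1.
Variables (F : V -> V -> R) (phi : R -> R -> R).
Hypothesis n2 : (2 <= n)%N.
Hypothesis hF : finsler_metric (RxBall n rho) F.
Hypothesis hFphi : forall x y : V, RxBall n rho x -> bar y != 0 ->
  F x y = enorm (bar y) * Num.sqrt (phi (y 0 0 / enorm (bar y)) (enorm (bar x))).

Let d : 'rV[R]_n := delta_mx 0 (Ordinal (ltnW n2)).
Let d1 : dotp d d = 1. Proof. by rewrite dotp_e mxE !eqxx. Qed.
Let enorm_d : enorm d = 1. Proof. by rewrite /enorm d1 sqrtr1. Qed.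
Let d_neq0 : d != 0.
Proof. by apply: contra_eq_neq d1 => ->; rewrite dotp0 eq_sym oner_neq0. Qed.

Definition profile (z r : R) : R := F (mkvec 0 (r *: d)) (mkvec z d) ^+ 2.

Lemma enorm_scale_d r : 0 < r -> enorm (r *: d) = r.
Proof.
by move=> r0; rewrite /enorm dotpZl dotpZr d1 mulr1 -expr2 sqrtr_sqr gtr0_norm.
Qed.

Lemma smooth2_profile : smooth2 rho profile.
Proof.
suff sF : dsmooth (strip rho) (fun p => F (mkvec 0 (p.2 *: d)) (mkvec p.1 d)).
  exact: (dsmoothM (@open_strip R rho) sF sF).
pose A (p : R * R) : V * V := (mkvec 0 (p.2 *: d), mkvec p.1 d).
pose L (p : R * R) : V * V := (mkvec 0 (p.2 *: d), mkvec p.1 0).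
apply: (@dsmooth_affine _ _ _ A L _ [set p | RxBall n rho p.1 /\ p.2 != 0]
   (fun p => F p.1 p.2) (@open_strip R rho)).
- move=> h q w; apply/pair_equal_spec; split=> /=.
    by rewrite -mkvecM mulr0 addr0 scalerDl scalerA.
  by rewrite -mkvecM scaler0 add0r.
- move=> p /andP[r0 rr]; split; last by apply: mkvec_neq0; rewrite d_neq0 orbT.
  by rewrite /RxBall /= bar_mkvec enorm_scale_d.
- exact: smooth_on_dsmooth hF.1.
Qed.

Lemma Fsq_profileE x y : 0 < enorm (bar x) < rho -> bar y != 0 ->
  Fsq F x y = mono 2 (profile ^~ (enorm (bar x))) y.
Proof.
move=> /andP[r0 rr] y0; rewrite /Fsq /mono /profile.
rewrite !hFphi ?bar_mkvec //; last by rewrite /RxBall /= bar_mkvec enorm_scale_d.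
rewrite mkvec0 enorm_scale_d // enorm_d divr1 mul1r.
by rewrite exprMn.
Qed.

Lemma half_hessian_posdef (x y v : V) : RxBall n rho x -> y != 0 -> v != 0 ->
  0 < (v *m half_hessian_sq (F x) y *m v^T) 0 0.
Proof. by move=> hx; case: (hF.2 x hx) => _ _ _; apply. Qed.

(** Where the profile vanishes, [Delta] would be [- profile_z^2 <= 0], against its
    positivity; so the profile is positive, the square root does not truncate,
    and [phi] inherits all that was proved about the profile. *)
Lemma profileE z r : 0 < r < rho -> profile z r = phi z r.
Proof.
move=> hr; have /andP[r0 rr] := hr.
have Dpos := Delta_gt0 n2 smooth2_profile half_hessian_posdef Fsq_profileE z hr.
have p0 : profile z r != 0.
  apply: contraTneq Dpos; rewrite /Delta => ->.
  by rewrite mulr0 mul0r sub0r oppr_gt0 -leNgt sqr_ge0.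
move: p0; rewrite /profile hFphi ?bar_mkvec //; last by rewrite /RxBall /= bar_mkvec enorm_scale_d.
rewrite mkvec0 enorm_scale_d // enorm_d divr1 mul1r sqrf_eq0 => s0.
apply: sqr_sqrtr; rewrite leNgt; apply: contra s0 => /ltW p0.
by rewrite ler0_sqrtr.
Qed.

Lemma smooth2_phi : smooth2 rho phi.
Proof.
apply: dsmooth_eq smooth2_profile; first exact: open_strip.
by move=> p hp; apply: profileE.
Qed.

Lemma Fsq_phiE x y : 0 < enorm (bar x) < rho -> bar y != 0 ->
  Fsq F x y = mono 2 (phi ^~ (enorm (bar x))) y.
Proof. by move=> hx y0; rewrite Fsq_profileE // /mono profileE. Qed.
End Profile.

(** * The four components *)

Theorem theorem4 (R : realType) (n : nat) (rho : R)
    (F : 'rV[R]_n.+1 -> 'rV[R]_n.+1 -> R) (phi : R -> R -> R)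
    (hn : (2 <= n)%N) (hrho : 0 < rho)
    (hphi : forall z r : R, 0 < r -> r < rho ->
      differentiable (fun p : R * R => phi p.1 p.2) (z, r))
    (hF : finsler_metric (RxBall n rho) F)
    (hFphi : forall x y : 'rV[R]_n.+1, RxBall n rho x -> bar y != 0 ->
      F x y = enorm (bar y) *
        Num.sqrt (phi (y 0 0 / enorm (bar y)) (enorm (bar x))))
    (x y : 'rV[R]_n.+1)
    (hx : RxBall n rho x) (hx0 : bar x != 0) (hy0 : bar y != 0) :
  let z := y 0 0 / enorm (bar y) in
  let r := enorm (bar x) in
  let u := enorm (bar y) in
  let s := dotp (bar x) (bar y) / enorm (bar y) in
  let xb := fun i : 'I_n => bar x 0 i in
  let yb := fun i : 'I_n => bar y 0 i in
  let up := fun i : 'I_n => lift ord0 i : 'I_n.+1 in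
  let L := fun A B C : 'I_n.+1 => landsberg F A B C x y in
  let phi_z := dz phi z r in
  let Om := Omega phi z r in
  let E := Ecoef phi z r in
  let E_z := dz (Ecoef phi) z r in
  let E_zz := dz (dz (Ecoef phi)) z r in
  let E_zzz := dz (dz (dz (Ecoef phi))) z r in
  let H_z := dz (Hcoef phi) z r in
  let H_zz := dz (dz (Hcoef phi)) z r in
  let H_zzz := dz (dz (dz (Hcoef phi))) z r in
  let W_z := dz (Wcoef phi) z r in
  let W_zz := dz (dz (Wcoef phi)) z r in
  let W_zzz := dz (dz (dz (Wcoef phi))) z r in
  [/\ L ord0 ord0 ord0 = - (s / 4) * (phi_z * E_zzz + Om * (H_zzz - W_zzz)),
      forall l : 'I_n,
        L ord0 ord0 (up l) =
          - 4^-1 * (phi_z * E_zz + Om * H_zz) * xb l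
          + s / (4 * u) * (phi_z * (E_zz + z * E_zzz)
                           + Om * (H_zz + z * H_zzz - z * W_zzz)) * yb l,
      forall k l : 'I_n,
        L ord0 (up k) (up l) =
          - (s / (4 * u ^+ 2)) *
              (z * phi_z * (z * E_zzz + 3 * E_zz)
               + Om * (H_z + 3 * z * H_zz + z ^+ 2 * H_zzz)
               + Om * (W_z - z * W_zz - z ^+ 2 * W_zzz)) * (yb k * yb l)
          + z / (4 * u) * (phi_z * E_zz + Om * H_zz)
              * (xb l * yb k + xb k * yb l)
          + s / 4 * (z * phi_z * E_zz
                     + Om * (H_z + z * H_zz + W_z - z * W_zz)) * kron R k l
    & forall j k l : 'I_n,
        L (up j) (up k) (up l) =
          - (s / (4 * u ^+ 3)) *
              (phi_z * (3 * E - 3 * z * E_z - 6 * z ^+ 2 * E_zz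
                        - z ^+ 3 * E_zzz)
               - Om * (6 * z * H_z + 6 * z ^+ 2 * H_zz + z ^+ 3 * H_zzz)
               - Om * (3 * z * W_z - 3 * z ^+ 2 * W_zz - z ^+ 3 * W_zzz))
              * (yb j * yb k * yb l)
          - 1 / (4 * u ^+ 2) *
              (phi_z * (- E + z * E_z + z ^+ 2 * E_zz)
               + Om * (z * H_z + z ^+ 2 * H_zz))
              * cyc (fun j k l => xb j * yb k * yb l) j k l
          - s / (4 * u) *
              (phi_z * (- E + z * E_z + z ^+ 2 * E_zz)
               + Om * (2 * z * H_z + z ^+ 2 * H_zz + z * W_z - z ^+ 2 * W_zz))
              * cyc (fun j k l => yb l * kron R j k) j k l
          - 4^-1 * (phi_z * (E - z * E_z) - z * Om * H_z)
              * cyc (fun j k l => xb l * kron R j k) j k l].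
Proof.
have hx' : 0 < enorm (bar x) < rho by rewrite enorm_gt0.
have sphi := smooth2_phi hn hF hFphi.
have pd := half_hessian_posdef hF.
have Fq := Fsq_phiE hn hF hFphi.
have D0 z r (hr : 0 < r < rho) := lt0r_neq0 (Delta_gt0 hn sphi pd Fq z hr).
have O0 z r (hr : 0 < r < rho) := lt0r_neq0 (Omega_gt0 hn sphi pd Fq z hr).
have sE := smooth1_slice (smooth2_Ecoef sphi D0) hx'.
have sH := smooth1_slice (smooth2_Hcoef sphi D0 O0) hx'.
have sW := smooth1_slice (smooth2_Wcoef sphi O0) hx'.
have LE A B C := landsberg_directional hn sphi pd Fq A B C hx' hy0.
cbv zeta in LE.
have jets (f : R -> R -> R) (sf : smooth1 (f ^~ (enorm (bar x)))) := (
  fun a t v w => mono3E a t v w sf hy0 (slice_derive f _) (slice_derive (dz f) _)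
    (slice_derive (dz (dz f)) _),
  fun a v w => mono2E a v w sf hy0 (slice_derive f _) (slice_derive (dz f) _),
  fun a v => mono1E a v hy0 (slice_derive f (enorm (bar x)))).
have jE := jets _ sE; have jH := jets _ sH; have jW := jets _ sW.
(* From here on only the values of [E], [H], [W] and of their z-derivatives
   matter; forgetting their definitions keeps the comparison of terms cheap. *)
move: LE jE jH jW.
generalize
  (Ecoef phi) (dz (Ecoef phi)) (dz (dz (Ecoef phi))) (dz (dz (dz (Ecoef phi))))
  (Hcoef phi) (dz (Hcoef phi)) (dz (dz (Hcoef phi))) (dz (dz (dz (Hcoef phi))))
  (Wcoef phi) (dz (Wcoef phi)) (dz (dz (Wcoef phi))) (dz (dz (dz (Wcoef phi)))).
move=> E0 E1 E2 E3 H0 H1 H2 H3 W0 W1 W2 W3 LE jE jH jW.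
move=> z r u s xb yb up L phi_z Om E E_z E_zz E_zzz H_z H_zz H_zzz W_z W_zz W_zzz.
have u0 : u != 0 by rewrite gt_eqF ?enorm_gt0.
have xy : dotp (bar x) (bar y) = s * u by rewrite /s -/u divfK.
have c0 : (delta_mx 0 ord0 : 'rV[R]_n.+1) 0 0 = 1 by rewrite mxE !eqxx.
have cS (i : 'I_n) : (delta_mx 0 (up i) : 'rV[R]_n.+1) 0 0 = 0 by rewrite mxE.
have d0 (v : 'rV[R]_n) : dotp v (bar (delta_mx 0 ord0 : 'rV[R]_n.+1)) = 0.
  by rewrite bar_e0 dotp0.
have d0' (v : 'rV[R]_n) : dotp (bar (delta_mx 0 ord0 : 'rV[R]_n.+1)) v = 0.
  by rewrite dotpC d0.
have dx i : dotp (bar x) (bar (delta_mx 0 (up i))) = xb i by rewrite bar_eS dotp_e.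
have dy i : dotp (bar y) (bar (delta_mx 0 (up i))) = yb i by rewrite bar_eS dotp_e.
have dd i k : dotp (bar (delta_mx 0 (up i))) (bar (delta_mx 0 (up k))) = kron R i k.
  by rewrite !bar_eS dotp_e mxE eqxx eq_sym.
have numE : ((0 : int)%:~R = 0 :> R) * ((1 : int)%:~R = 1 :> R) *
  ((2 : int)%:~R = 2 :> R) * (u ^ 0 = 1) * (u ^ 1 = u) * (u ^ 2 = u ^+ 2) by [].
have components A B C : L A B C = _ := LE A B C.
rewrite {}/E {}/E_z {}/E_zz {}/E_zzz {}/H_z {}/H_zz {}/H_zzz {}/W_z {}/W_zz {}/W_zzz.
split=> [|l|k l|j k l]; rewrite components /lin_mono3 /lin_mono2 !jE !jH !jW -/r -/u -/z
  !numE !(c0, cS, d0, d0', dx, dy, dd, xy) -/phi_z -/Om;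
  clearbody phi_z Om z r u s xb yb.
- by field.
- by field.
- by field.
- have kC : kron R j l = kron R l j by rewrite /kron eq_sym.
  by rewrite /cyc kC; field.
Qed.
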